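(* Let $R=\mathbb F_2^m\oplus\mathbb F_2^d$, and let $(R,+,\cdot_\phi)$ and $(R,+,\cdot_\psi)$ be two nilpotent algebras of class two over $\mathbb F_2$ with defining matrices $B_1,\dots,B_d$ and $C_1,\dots,C_d$, respectively. If the matrix spaces $\langle B_1,\dots,B_d\rangle$ and $\langle C_1,\dots,C_d\rangle$ have different sequences of ranks, then the two algebras are not isomorphic.
   Context: Given a nondegenerate bilinear map $\phi:\mathbb F_2^m\times\mathbb F_2^m\to\mathbb F_2^d$ (no nonzero $x$ satisfies $\phi(x,y)=0$ for all $y$, and no nonzero $y$ satisfies $\phi(x,y)=0$ for all $x$), the product $\cdot_\phi$ on $R=\mathbb F_2^m\oplus\mathbb F_2^d$ is $$(x_1,y_1)\cdot_\phi(x_2,y_2)=(0,\phi(x_1,x_2)).$$ The defining matrices of $(R,+,\cdot_\phi)$ are the $m\times m$ matrices $B_1,\dots,B_d$ over $\mathbb F_2$ with $\phi(x_1,x_2)=(x_1B_1x_2^t,\dots,x_1B_dx_2^t)$ for all $x_1,x_2\in\mathbb F_2^m$ (row vectors). Here $\phi$ and $\psi$ are nondegenerate bilinear maps. The sequence of ranks of a $k$-dimensional subspace $\mathcal B\subseteq\mathbb F_2^{m\times m}$ is the sequence $(r_1,\dots,r_{2^k-1})$ of the ranks of the $2^k-1$ nonzero matrices of $\mathcal B$, listed in non-decreasing order $r_1\le r_2\le\dots\le r_{2^k-1}$. *)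

(* Defs.v *)
From HB Require Import structures.
From mathcomp Require Import all_boot all_order all_algebra.
From mathcomp Require Import sesquilinear.

Set Implicit Arguments.
Unset Strict Implicit.
Unset Printing Implicit Defensive.

Import GRing.Theory.
Local Open Scope ring_scope.

Definition nondegenerate_bilinear (F : fieldType) (U V W : lmodType F)
    (phi : {bilinear U -> V -> W}) : Prop :=
  (forall x : U, (forall y : V, phi x y = 0) -> x = 0) /\
  (forall y : V, (forall x : U, phi x y = 0) -> y = 0).

Section Product.

Variables (F : fieldType) (U W : lmodType F) (phi : {bilinear U -> U -> W}).

Definition alg_mul (u v : U * W) : U * W := (0, phi u.1 v.1).

Fact alg_mul_bilinear : bilinear_for *:%R *:%R alg_mul.
Proof.
by split=> w a u v; rewrite /alg_mul; congr pair => /=;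
  rewrite ?scaler0 ?addr0 ?linearPl ?linearPr.
Qed.

HB.instance Definition _ :=
  bilinear_isBilinear.Build F (U * W)%type (U * W)%type (U * W)%type
    *:%R *:%R alg_mul alg_mul_bilinear.

End Product.

(* MathComp's algebra structures are unital, which a nonzero nilpotent algebra
   never is: an F-algebra is given here by its bilinear product on an
   lmodType. *)
Definition alg_isomorphic (F : fieldType) (V W : lmodType F)
    (mulV : {bilinear V -> V -> V}) (mulW : {bilinear W -> W -> W}) : Prop :=
  exists f : {linear V -> W},
    bijective f /\ {morph f : x y / mulV x y >-> mulW x y}.

Definition defining_matrices (F : fieldType) (m d : nat)
    (phi : {bilinear 'rV[F]_m -> 'rV[F]_m -> 'rV[F]_d})
    (B : 'I_d -> 'M[F]_m) : Prop :=
  forall x y : 'rV[F]_m, phi x y = \row_k (x *m B k *m y^T) 0 0.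

Definition matrix_space (F : fieldType) (m d : nat) (B : 'I_d -> 'M[F]_m) :
    {vspace 'M[F]_m} :=
  <<[seq B k | k : 'I_d]>>%VS.

Definition rank_sequence (F : finFieldType) (m : nat) (S : {vspace 'M[F]_m}) :
    seq nat :=
  sort leq [seq \rank A | A : 'M[F]_m in [pred A | (A \in S) && (A != 0)]].

(* Main.v *)
Require Import Defs.
From HB Require Import structures.
From mathcomp Require Import all_boot all_order all_algebra.
From mathcomp Require Import sesquilinear.

Import GRing.Theory.
Local Open Scope ring_scope.

(** An isomorphism [f] preserves the annihilator, which by nondegeneracy is the
    summand [F^d]; hence it induces invertible matrices [P] on [F^m] and [D] on
    [F^d] with [psi (x P) (y P) = phi x y D].  In terms of the defining matrices
    this reads [P C_k P^T = \sum_j D_jk B_j], so the rank-preserving bijection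
    [X |-> P X P^T] carries the span of the [C_k] onto that of the [B_j]. *)

Lemma linear_rV_mulmx (F : fieldType) (m n : nat) (h : 'rV[F]_m -> 'rV[F]_n) :
  linear h -> exists A : 'M[F]_(m, n), forall x, h x = x *m A.
Proof.
move=> hL.
pose H : {linear 'rV[F]_m -> 'rV[F]_n} :=
  HB.pack h (GRing.isLinear.Build F _ _ _ h hL).
by exists (lin1_mx H) => x; rewrite mul_rV_lin1.
Qed.

Lemma unitmx_inj (F : fieldType) (n : nat) (A : 'M[F]_n) :
  (forall x : 'rV_n, x *m A = 0 -> x = 0) -> A \in unitmx.
Proof.
move=> Ainj; rewrite -row_free_unit -kermx_eq0; apply/eqP/row_matrixP => i.
by rewrite row0; apply: Ainj; rewrite -row_mul mulmx_ker row0.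
Qed.

Lemma alg_isomorphic_mulmx (F : fieldType) (m d : nat)
    (phi psi : {bilinear 'rV[F]_m -> 'rV[F]_m -> 'rV[F]_d}) :
  nondegenerate_bilinear phi -> nondegenerate_bilinear psi ->
  alg_isomorphic (alg_mul phi) (alg_mul psi) ->
  exists (P : 'M[F]_m) (D : 'M[F]_d),
    [/\ P \in unitmx, D \in unitmx &
        forall x y, psi (x *m P) (y *m P) = phi x y *m D].
Proof.
move=> [phi_nd _] [psi_nd _] [f [[g fK gK] fM]].
have f_inj := can_inj fK.
have fE u v : f (0, phi u.1 v.1) = (0, psi (f u).1 (f v).1) by exact: fM.
(* [(0, y)] multiplies everything to zero. Since [f] is onto, every [w] is the first component of
   some image, so [psi (f (0, y)).1 w = 0] for all [w], and nondegeneracy of [psi] applies. *)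
have f_ann y : (f (0, y)).1 = 0.
  apply: psi_nd => w; have := fE (0, y) (g (w, 0)).
  by rewrite gK /= linear0l linear0; case.
(* [f (x, 0)] may also have a component in [F^d], but products in the target read first components
   only. *)
have [P PE] : exists P : 'M[F]_m, forall x, (f (x, 0)).1 = x *m P.
  apply: linear_rV_mulmx => a x y.
  have -> : (a *: x + y, 0) = a *: (x, 0) + (y, 0) :> 'rV[F]_m * 'rV[F]_d.
    by congr pair; rewrite /= scaler0 addr0.
  by rewrite linearP.
have [D DE] : exists D : 'M[F]_d, forall y, (f (0, y)).2 = y *m D.
  apply: linear_rV_mulmx => a x y.
  have -> : (0, a *: x + y) = a *: (0, x) + (0, y) :> 'rV[F]_m * 'rV[F]_d.
    by congr pair; rewrite /= scaler0 addr0.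
  by rewrite linearP.
have PD x y : psi (x *m P) (y *m P) = phi x y *m D.
  by rewrite -!PE -[RHS]DE (fE (x, 0) (y, 0)).
have D0 (y : 'rV[F]_d) : y *m D = 0 -> y = 0.
  rewrite -DE => fy0; suff [] : (0, y) = 0 :> 'rV[F]_m * 'rV[F]_d by [].
  by apply: f_inj; rewrite linear0 [LHS]surjective_pairing f_ann fy0.
(* If [x P = 0], then [phi x y D = psi 0 (y P) = 0] for all [y]; injectivity of [D] and
   nondegeneracy of [phi] force [x = 0]. *)
exists P, D; split=> //; apply: unitmx_inj => // x xP0.
by apply: phi_nd => y; apply: D0; rewrite -PD xP0 linear0l.
Qed.

(** Evaluating at standard basis vectors reads off the entries. *)
Lemma mulmx_form_inj (F : fieldType) (m n : nat) (M N : 'M[F]_(m, n)) :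
  (forall (x : 'rV_m) (y : 'rV_n),
     (x *m M *m y^T) 0 0 = (x *m N *m y^T) 0 0) -> M = N.
Proof.
move=> MN; apply/matrixP => i j.
have := MN (delta_mx 0 i) (delta_mx 0 j).
by rewrite trmx_delta -!rowE -!colE !mxE.
Qed.

(** The map [X |-> P X Q] is linear, so its values on the generators [C k] decide the inclusion. *)
Lemma matrix_space_mulmx (F : fieldType) (m d : nat) (P Q : 'M[F]_m)
    (B C : 'I_d -> 'M[F]_m) (D : 'M[F]_d) :
  (forall k, P *m C k *m Q = \sum_j D j k *: B j) ->
  forall X, X \in matrix_space C -> P *m X *m Q \in matrix_space B.
Proof.
move=> PCQ X XC; pose h := linfun (mulmxr Q \o mulmx P).
have -> : P *m X *m Q = h X by rewrite lfunE.
suff /subvP : (h @: matrix_space C <= matrix_space B)%VS.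
  by apply; apply: memv_img.
rewrite /matrix_space limg_span; apply/span_subvP => _ /mapP[_ /mapP[k _ ->] ->].
rewrite lfunE /= PCQ; apply: rpred_sum => j _; apply: rpredZ.
by apply/memv_span/map_f; rewrite mem_enum.
Qed.

Lemma rank_sequence_mulmx (F : finFieldType) (m : nat) (P Q : 'M[F]_m)
    (S T : {vspace 'M[F]_m}) :
  P \in unitmx -> Q \in unitmx ->
  (forall X, (P *m X *m Q \in S) = (X \in T)) ->
  rank_sequence S = rank_sequence T.
Proof.
move=> uP uQ ST; pose h (X : 'M[F]_m) := P *m X *m Q.
pose h' (X : 'M[F]_m) := invmx P *m X *m invmx Q.
have hK : cancel h h' by move=> X; rewrite /h /h' -!mulmxA mulmxV // mulmx1 mulKmx.
have h'K : cancel h' h.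
  by move=> X; rewrite /h /h' -!mulmxA mulVmx // mulmx1 mulKVmx.
have h0 X : (h X == 0) = (X == 0).
  by rewrite -[RHS](inj_eq (can_inj hK)) /h mulmx0 mul0mx.
apply/perm_sortP; [exact: leq_total | exact: leq_trans | exact: anti_leq |].
have rk X : \rank (h X) = \rank X.
  by rewrite mxrankMfree ?row_free_unit // eqmxMfull // row_full_unit.
(* Replacing [\rank X] by [\rank (h X)] on the side of [T] leaves a claim without ranks: [h] maps
   the nonzero elements of [T] bijectively onto those of [S]. *)
rewrite /image_mem perm_sym -(eq_map rk) (map_comp (fun X => \rank X) h); apply: perm_map.
apply: uniq_perm; rewrite ?(map_inj_uniq (can_inj hK)) ?enum_uniq // => X.
by rewrite -[X]h'K (mem_map (can_inj hK)) !mem_enum !inE h0 ST.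
Qed.

Theorem theorem3p5 (m d : nat)
    (phi psi : {bilinear 'rV['F_2]_m -> 'rV['F_2]_m -> 'rV['F_2]_d})
    (B C : 'I_d -> 'M['F_2]_m) :
  nondegenerate_bilinear phi -> nondegenerate_bilinear psi ->
  defining_matrices phi B -> defining_matrices psi C ->
  rank_sequence (matrix_space B) <> rank_sequence (matrix_space C) ->
  ~ alg_isomorphic (alg_mul phi) (alg_mul psi).
Proof.
move=> phi_nd psi_nd phiB psiC neq_rk iso; apply: neq_rk.
have [P [D [uP uD PD]]] := alg_isomorphic_mulmx _ _ _ _ _ phi_nd psi_nd iso.
have PCP k : P *m C k *m P^T = \sum_j D j k *: B j.
  apply: mulmx_form_inj => x y.
  have /rowP/(_ k) := PD x y; rewrite psiC phiB mxE [RHS]mxE trmx_mul !mulmxA => ->.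
  rewrite mulmx_sumr mulmx_suml summxE; apply: eq_bigr => j _.
  by rewrite -scalemxAr -scalemxAl mxE [RHS]mxE mulrC.
(* Inverting the relations [PCP] by means of [invmx D] yields the reverse inclusion of the two
   spans. *)
have BP j : invmx P *m B j *m invmx P^T = \sum_k (invmx D) k j *: C k.
  have -> : B j = P *m (\sum_k (invmx D) k j *: C k) *m P^T.
    rewrite mulmx_sumr mulmx_suml.
    under eq_bigr do rewrite -scalemxAr -scalemxAl PCP scaler_sumr.
    rewrite exchange_big /=.
    (* The coefficient of [B i] is the [(i, j)] entry of [D *m invmx D = 1]. *)
    have DV i : \sum_k invmx D k j *: (D i k *: B i) = (i == j)%:R *: B i.
      have /matrixP/(_ i j) := mulmxV uD; rewrite !mxE => <-.
      by rewrite scaler_suml; apply: eq_bigr => k _; rewrite scalerA mulrC.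
    rewrite (eq_bigr _ (fun i _ => DV i)) (bigD1 j) //= eqxx scale1r.
    by rewrite big1 ?addr0 // => i /negbTE->; rewrite scale0r.
  by rewrite -!mulmxA mulKmx // mulmxV ?unitmx_tr // mulmx1.
apply: (rank_sequence_mulmx _ _ P P^T); rewrite ?unitmx_tr // => X.
apply/idP/idP; last exact: matrix_space_mulmx PCP X.
(* The inverse congruence carries [P X P^T] back to [X]. *)
move=> /(matrix_space_mulmx _ _ _ _ _ _ _ _ BP).
by rewrite -!mulmxA mulKmx // mulmxV ?unitmx_tr // mulmx1.
Qed.
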